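(* Let $I$ be a monomial ideal in a polynomial ring $R$ over a field and suppose that for every variable $x\in R$ we have $d_x(M)=d_x(I)$ for every monomial $M\in\mathcal{G}(I)$ such that $x\mid M$. Let $b_0,b_1,\ldots,b_t$ be distinct variables in $R$ such that if $b_0\mid M$ for some monomial $M\in\mathcal{G}(I)$, then $b_i\mid M$ for some $1\le i\le t$. If $f=b_0+\cdots+b_t$, then $f$ is regular on $R/I$.
   Context: For a monomial ideal $I$, $\mathcal{G}(I)$ denotes its set of (minimal) monomial generators. For a variable $x$ and a monomial $M$, $d_x(M)$ is the degree of $x$ in $M$, and $d_x(I)=\max\{d_x(M)\mid M\in\mathcal{G}(I)\}$. An element is regular on $R/I$ if it is a nonzerodivisor on $R/I$. *)

(* Defs.v *)
From HB Require Import structures.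
From mathcomp Require Import all_boot all_order all_algebra.
From mathcomp Require Import generic_quotient ring_quotient mpoly.

Set Implicit Arguments.
Unset Strict Implicit.
Unset Printing Implicit Defensive.

Import GRing.Theory.
Local Open Scope ring_scope.
Local Open Scope quotient_scope.

Definition ideal_gen (A : comNzRingType) (S : A -> Prop) (p : A) : Prop :=
  exists2 s : seq (A * A),
    (forall c, c \in s -> S c.2) & p = \sum_(c <- s) c.1 * c.2.

(* The library structure [idealr] only covers proper ideals, whereas the unit
   ideal is a monomial ideal (generated by 'X_[0] = 1).  So ideals are carried
   by [zmodClosed], which is all that [{ideal_quot I}] needs. *)
Definition monomial_ideal (K : fieldType) (n : nat)
    (I : zmodClosed {mpoly K[n]}) : Prop :=
  exists S : 'X_{1..n} -> Prop, forall p : {mpoly K[n]},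
    p \in I <-> ideal_gen (fun q => exists2 m, S m & q = 'X_[m]) p.

(* G(I): the monomials of I that are minimal for divisibility, which is the
   pointwise order on exponents. *)
Definition mingen (K : fieldType) (n : nat) (I : zmodClosed {mpoly K[n]})
    (m : 'X_{1..n}) : Prop :=
  'X_[m] \in I /\
  forall m' : 'X_{1..n}, 'X_[m'] \in I -> (m' <= m)%MM -> m' = m.

(* d = d_x(I), the maximum of the exponents of x over G(I). *)
Definition is_degree (K : fieldType) (n : nat) (I : zmodClosed {mpoly K[n]})
    (x : 'I_n) (d : nat) : Prop :=
  (exists2 m, mingen I m & m x = d) /\
  (forall m, mingen I m -> (m x <= d)%N).

(* Multiplication by f on the quotient A / I; [quot_scale_pi] shows that it
   does not depend on the representative when I is an ideal. *)
Definition quot_scale (A : comNzRingType) (I : zmodClosed A) (f : A)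
    (u : {ideal_quot I}) : {ideal_quot I} :=
  \pi_({ideal_quot I}) (f * repr u).

Definition regular_on_quot (A : comNzRingType) (I : zmodClosed A) (f : A)
    : Prop :=
  forall u : {ideal_quot I}, quot_scale f u = 0 -> u = 0.

Lemma quot_scale_pi (A : comNzRingType) (I : zmodClosed A) (f g : A) :
  (forall a, {in I, forall u, a * u \in I}) ->
  quot_scale f (\pi_({ideal_quot I}) g) = \pi_({ideal_quot I}) (f * g).
Proof.
move=> idI; apply/eqP.
by rewrite /quot_scale -Quotient.idealrBE -mulrBr idI // Quotient.idealrBE reprK.
Qed.

Lemma quot_pi_eq0 (A : comNzRingType) (I : zmodClosed A) (g : A) :
  (\pi_({ideal_quot I}) g = 0) <-> (g \in I).
Proof.
have pi0 : \pi_({ideal_quot I}) 0 = 0 by rewrite raddf0.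
rewrite -{2}(subr0 g) Quotient.idealrBE pi0.
by split=> [-> | /eqP] //.
Qed.

Lemma regular_on_quotP (A : comNzRingType) (I : zmodClosed A) (f : A) :
  (forall a, {in I, forall u, a * u \in I}) ->
  regular_on_quot I f <-> (forall g, f * g \in I -> g \in I).
Proof.
move=> idI; split=> [reg g fgI | reg u].
  apply/quot_pi_eq0/reg; rewrite quot_scale_pi //; exact/quot_pi_eq0.
rewrite -[u]reprK quot_scale_pi // => /quot_pi_eq0/reg uI.
exact/quot_pi_eq0.
Qed.

Lemma monomial_ideal_closed (K : fieldType) (n : nat)
    (I : zmodClosed {mpoly K[n]}) :
  monomial_ideal I -> forall a, {in I, forall u, a * u \in I}.
Proof.
move=> [S IS] a u /IS [s sS ->]; apply/IS.
exists [seq (a * c.1, c.2) | c <- s].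
  by move=> _ /mapP [c cs ->]; apply: (sS c).
by rewrite big_map mulr_sumr; apply: eq_bigr => c _; rewrite mulrA.
Qed.

(* Main.v *)
Require Import Defs.
From mathcomp Require Import all_boot all_order all_algebra.
From mathcomp Require Import generic_quotient ring_quotient mpoly.
From Stdlib Require Import Classical_Prop.
Local Open Scope ring_scope.

(** Because every variable x occurs in the generators with exponent 0 or
    d_x = d_x(I) only, I behaves like a squarefree monomial ideal: it is the
    intersection of the ideals Q_C generated by the powers x^(d_x), x in C,
    where C ranges over the minimal sets of variables that meet the support of
    every generator (the minimal vertex covers of the hypergraph of supports).
    Each Q_C is primary to the prime generated by C, so f is regular on R/I as
    soon as no such C contains all the variables of f.  If C contained all the
    b_i, then by minimality some generator M would have b_0 as its only variable
    in C, whereas the hypothesis provides a b_i dividing M, with i >= 1.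

    The proof makes this concrete on exponents.  Suppose fg is in I while some
    monomial m of g is not.  The x with m_x < d_x form a cover, since otherwise
    a generator would divide m; hence m is outside Q_C for some minimal cover C
    ([minimal_cover_not_dvd]).  Some variable of f is missing from C
    ([minimal_cover_missed]), so fg has a monomial outside Q_C
    ([msupp_linear_mul_outside]).  As C is a cover, Q_C contains I, and all
    monomials of fg lie in I: a contradiction. *)

Import GRing.Theory.

(** * Monomial ideals and their minimal generators *)

Section MonomialIdeal.

Context {K : fieldType} {n : nat} {I : zmodClosed {mpoly K[n]}}.
Context (Imon : monomial_ideal I).

Lemma monomial_ideal_le (m m' : 'X_{1..n}) :
  (m <= m')%MM -> 'X_[m] \in I -> 'X_[m'] \in I.
Proof.
move=> le_mm' mI; rewrite -(submK le_mm') mpolyXD.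
exact: (monomial_ideal_closed Imon).
Qed.

Lemma monomial_ideal_msupp (p : {mpoly K[n]}) :
  p \in I <-> {in msupp p, forall m, 'X_[m] \in I}.
Proof.
split=> [pI m | suppI]; last first.
  rewrite (mpolyE p) big_seq; apply: rpred_sum => m /suppI mI.
  by rewrite -mul_mpolyC; apply: (monomial_ideal_closed Imon).
have [S IS] := Imon; have [s sS p_def] := (IS p).1 pI.
rewrite mcoeff_msupp {1}p_def raddf_sum /= => nz_m.
have [c cs nz_c] : exists2 c, c \in s & (c.1 * c.2)@_m != 0.
  apply/hasP; apply: contraNT nz_m => /hasPn s0; apply/eqP.
  by rewrite big_seq big1 // => c /s0 /negPn/eqP.
have [k Sk c2_def] := sS c cs; have kI : 'X_[k] \in I.
  apply/IS; exists [:: (1, 'X_[k])] => [c'|]; last by rewrite big_seq1 mul1r.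
  by rewrite inE => /eqP ->; exists k.
move: nz_c; rewrite c2_def -mcoeff_msupp (perm_mem (msuppMX _ _)).
by case/mapP=> k' _ ->; apply: monomial_ideal_le kI; apply: lem_addr.
Qed.

Lemma mingen_dvd (m : 'X_{1..n}) :
  'X_[m] \in I -> exists2 M, mingen I M & (M <= m)%MM.
Proof.
have [k] := ubnP (mdeg m); elim: k m => // k IHk m lt_mk mI.
have [Gm | notGm] := classic (mingen I m); first by exists m; rewrite ?lepm_refl.
have [m' [m'I le_m'm neq_m'm]] :
    exists m' : 'X_{1..n}, [/\ 'X_[m'] \in I, (m' <= m)%MM & m' <> m].
  apply: NNPP => no_m'; apply: notGm; split=> // m' m'I le_m'm.
  by apply: NNPP => neq_m'm; apply: no_m'; exists m'.
have lt_m'm : (mdeg m' < mdeg m)%N.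
  rewrite -(submK le_m'm) mdegD -[X in (X < _)%N]add0n ltn_add2r lt0n mdeg_eq0.
  apply/eqP => d0; apply: neq_m'm.
  by rewrite -(submK le_m'm) d0 add0m.
have [|M GM le_Mm'] := IHk m' _ m'I; first exact: leq_trans lt_m'm lt_mk.
by exists M => //; apply: lepm_trans le_Mm' le_m'm.
Qed.

End MonomialIdeal.

(** * Linear forms modulo an irreducible monomial ideal *)

(** The monomials that are not in the ideal generated by the x^(d x), x in C. *)
Definition outside {n : nat} (C : {set 'I_n}) (d : 'I_n -> nat)
    (m : 'X_{1..n}) : bool := [forall x in C, (m x < d x)%N].

Lemma outside_le {n : nat} (C : {set 'I_n}) (d : 'I_n -> nat)
    (m m' : 'X_{1..n}) :
  {in C, forall x, (m' x <= m x)%N} -> outside C d m -> outside C d m'.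
Proof.
move=> le_m'm /forall_inP lt_md; apply/forall_inP => x xC.
exact: leq_ltn_trans (le_m'm x xC) (lt_md x xC).
Qed.

Lemma ex_minimizer {T : eqType} (s : seq T) (P : pred T) (w : T -> nat) :
  has P s -> exists m, [/\ m \in s, P m &
    {in s, forall m', P m' -> (w m <= w m')%N}].
Proof.
move=> /hasP [m0 m0s Pm0].
pose Q k := has (fun m => P m && (w m == k)) s.
have exQ : exists k, Q k by exists (w m0); apply/hasP; exists m0; rewrite ?Pm0 /=.
case: (ex_minnP exQ) => k /hasP [m ms /andP [Pm /eqP <-]] min_m.
exists m; split=> // m' m's Pm'; apply: min_m.
by apply/hasP; exists m' => //; rewrite Pm' /=.
Qed.

(** A linear form with a variable b i outside C is regular modulo the ideal
    Q_C of the x^(d x), x in C.  Among the monomials of g outside Q_C, take m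
    with the least degree in the variables of C and, among those, with the
    greatest exponent of b i.  Then m * b i arises in only one way in the
    product, so it does not cancel: for m * b i = m' * b j with j != i, the
    monomial m' has a smaller degree in C if b j is in C, and otherwise the same
    degree in C but a greater exponent of b i. *)
Lemma msupp_linear_mul_outside {R : nzRingType} {n t : nat} (C : {set 'I_n})
    (d : 'I_n -> nat) (b : 'I_t -> 'I_n) (i : 'I_t) (g : {mpoly R[n]}) :
  injective b -> b i \notin C -> has (outside C d) (msupp g) ->
  has (outside C d) (msupp ((\sum_(j < t) 'X_(b j)) * g)).
Proof.
move=> b_inj biC g_out.
pose degC (m : 'X_{1..n}) := (\sum_(x in C) m x)%N.
have [m1 [m1g m1out m1min]] := ex_minimizer _ _ degC g_out.
pose P m := outside C d m && (degC m == degC m1).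
have hasP1 : has P (msupp g) by apply/hasP; exists m1; rewrite // /P m1out /=.
(* Exponents in g are below msize g, so this weight maximizes that of b i. *)
have [m [mg /andP [mout /eqP m_deg] mmax]] :=
  ex_minimizer _ _ (fun m : 'X_{1..n} => (msize g - m (b i))%N) hasP1.
apply/hasP; exists (m + U_(b i))%MM; last first.
  apply: outside_le mout => x xC; rewrite mnmDE mnm1E.
  by case: eqP => [bi_x | _]; rewrite ?addn0 //; rewrite bi_x xC in biC.
rewrite mcoeff_msupp mulr_suml raddf_sum (bigD1 i) //= big1 ?addr0.
  by rewrite -commr_mpolyX addmC mcoeffMX -mcoeff_msupp.
move=> j neq_ji; apply: memN_msupp_eq0; apply/negP.
rewrite -commr_mpolyX (perm_mem (msuppMX _ _)) => /mapP [m' m'g eq_m].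
have neq_b : b j != b i by rewrite (inj_eq b_inj).
have exp x : (m x + (b i == x) = (b j == x) + m' x)%N.
  by have /mnmP/(_ x) := eq_m; rewrite !mnmDE !mnm1E.
have m'_out : outside C d m'.
  apply: outside_le mout => x xC; have := exp x.
  case: (b i =P x) => [bi_x | _]; first by rewrite bi_x xC in biC.
  by rewrite addn0 => ->; apply: leq_addl.
have degE : degC m = ((b j \in C) + degC m')%N.
  transitivity (\sum_(x in C) ((b j == x) + m' x))%N.
    apply: eq_bigr => x xC; rewrite -exp.
    by case: eqP => [bi_x | _]; rewrite ?addn0 //; rewrite bi_x xC in biC.
  rewrite big_split /=; congr (_ + _)%N.
  case: (boolP (b j \in C)) => bjC.
    rewrite (bigD1 (b j)) //= eqxx big1 // => x /andP [_].
    by rewrite eq_sym => /negPf ->.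
  by rewrite big1 // => x xC; case: eqP => // bj_x; rewrite bj_x xC in bjC.
have := m1min _ m'g m'_out; rewrite -m_deg degE.
case: (b j \in C) degE; first by rewrite add1n ltnn.
rewrite add0n => eq_deg _.
have Pm' : P m' by rewrite /P m'_out -m_deg eq_deg /=.
have := mmax m' m'g Pm'.
have := exp (b i); rewrite eqxx (negPf neq_b) addn1 add0n => <-.
have lt_mi : (m (b i) < msize g)%N.
  apply: leq_ltn_trans (msize_mdeg_lt mg).
  by rewrite mdegE (bigD1 (b i)) //= leq_addr.
by rewrite leqNgt ltn_sub2l.
Qed.

(** * Vertex covers of the supports of the generators *)

Definition mnm_support {n : nat} (m : 'X_{1..n}) : {set 'I_n} :=
  [set x | m x != 0%N].

Definition vertex_cover {T : finType} (F : {set {set T}}) (C : {set T}) :=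
  [forall S in F, S :&: C != set0].

(** Removing v from a minimal cover uncovers some S, which therefore meets C
    in v alone. *)
Lemma minimal_cover_private {T : finType} (F : {set {set T}}) (C : {set T})
    (v : T) :
  minset (vertex_cover F) C -> v \in C -> exists2 S, S \in F & S :&: C = [set v].
Proof.
move=> /minsetP [covC minC] vC.
have /forall_inPn [S SF] : ~~ vertex_cover F (C :\ v).
  apply/negP => /minC/(_ (subD1set _ _)) C_def.
  by move: vC; rewrite -C_def !inE eqxx.
rewrite negbK => /eqP SCv0; exists S => //.
have SCv : S :&: C \subset [set v].
  apply/subsetP => x /setIP [xS xC]; rewrite inE; apply: contraT => xv.
  by have := in_set0 x; rewrite -SCv0 !inE xS xC xv.
by apply/eqP; rewrite eqEcard SCv cards1 card_gt0 (forall_inP covC).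
Qed.

Section Covers.

Context {K : fieldType} {n : nat} {I : zmodClosed {mpoly K[n]}}.
Context {F : {set {set 'I_n}}} {d : 'I_n -> nat}.
Context (Imon : monomial_ideal I).
Context (FP :
  forall S, S \in F <-> exists2 M, mingen I M & mnm_support M = S).
Context (dP :
  forall x M, mingen I M -> x \in mnm_support M -> M x = d x).

(** A generator that does not divide m exceeds m at some variable x, where its
    exponent is d x; thus the x with m x < d x form a cover. *)
Lemma minimal_cover_not_dvd (m : 'X_{1..n}) :
  'X_[m] \notin I -> exists2 C, minset (vertex_cover F) C & outside C d m.
Proof.
move=> mI.
have covA : vertex_cover F [set x | (m x < d x)%N].
  apply/forall_inP => _ /FP [M GM <-]; apply/set0Pn.
  have : ~~ (M <= m)%MM by apply: contra mI => /(monomial_ideal_le Imon)->; case: GM.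
  case/forallPn=> x; rewrite -ltnNge => lt_mM.
  have xM : x \in mnm_support M by rewrite inE -lt0n; apply: leq_trans lt_mM.
  by exists x; rewrite inE xM inE -(dP x M).
have [C minC /subsetP sCA] := minset_exists covA.
by exists C => //; apply/forall_inP => x /sCA; rewrite inE.
Qed.

Lemma vertex_cover_in_ideal (C : {set 'I_n}) (m : 'X_{1..n}) :
  vertex_cover F C -> 'X_[m] \in I -> ~~ outside C d m.
Proof.
move=> /forall_inP covC /(mingen_dvd) [M GM /mnm_lepP le_Mm].
have /covC/set0Pn [x /setIP [xM xC]] : mnm_support M \in F by apply/FP; exists M.
by apply/forall_inPn; exists x => //; rewrite -leqNgt -(dP x M).
Qed.

Lemma minimal_cover_missed {t : nat} (b : 'I_t.+1 -> 'I_n) (C : {set 'I_n}) :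
  injective b ->
  (forall M, mingen I M -> b ord0 \in mnm_support M ->
    exists2 i : 'I_t.+1, (1 <= i)%N & b i \in mnm_support M) ->
  minset (vertex_cover F) C -> exists i, b i \notin C.
Proof.
move=> b_inj hb minC.
have [b0C | b0C] := boolP (b ord0 \in C); last by exists ord0.
have [_ /FP [M GM <-] MC] := minimal_cover_private F C (b ord0) minC b0C.
have /setIP [b0M _] : b ord0 \in mnm_support M :&: C by rewrite MC set11.
have [i i_gt0 biM] := hb M GM b0M; exists i; apply/negP => biC.
have : b i \in mnm_support M :&: C by rewrite inE biM.
by rewrite MC inE => /eqP/b_inj i0; rewrite i0 in i_gt0.
Qed.

End Covers.

Theorem corollary2p16 (K : fieldType) (n : nat) (I : zmodClosed {mpoly K[n]})
    (Imon : monomial_ideal I)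
    (Ideg : forall (x : 'I_n) (M : 'X_{1..n}),
      mingen I M -> (U_(x) <= M)%MM -> is_degree I x (M x))
    (t : nat) (b : 'I_t.+1 -> 'I_n) (b_inj : injective b)
    (hb : forall M : 'X_{1..n}, mingen I M -> (U_(b ord0) <= M)%MM ->
      exists2 i : 'I_t.+1, (1 <= i)%N & (U_(b i) <= M)%MM) :
  regular_on_quot I (\sum_(i < t.+1) 'X_(b i)).
Proof.
have suppE x (M : 'X_{1..n}) : (x \in mnm_support M) = (U_(x) <= M)%MM.
  by rewrite inE lep1mP.
have /fin_all_exists [d dP] x : exists k, forall M,
    mingen I M -> x \in mnm_support M -> M x = k.
  have [[M GM xM] | noM] :=
    classic (exists2 M, mingen I M & x \in mnm_support M).
    exists (M x) => M' GM' xM'; rewrite !suppE in xM xM'.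
    have [_ leM] := Ideg x M GM xM; have [_ leM'] := Ideg x M' GM' xM'.
    by apply/eqP; rewrite eqn_leq leM ?leM'.
  by exists 0%N => M GM xM; case: noM; exists M.
(* The supports form a finite set of sets, which the boolean-valued notion of
   minimal cover requires. *)
have /fin_all_exists [h hP] S : exists v : bool,
    v <-> exists2 M, mingen I M & mnm_support M = S.
  have [GS | noGS] := classic (exists2 M, mingen I M & mnm_support M = S).
    by exists true.
  by exists false.
have FP S :
    S \in [set S' | h S'] <-> exists2 M, mingen I M & mnm_support M = S.
  by rewrite inE.
apply/regular_on_quotP; first exact: monomial_ideal_closed Imon.
move=> g /(monomial_ideal_msupp Imon) fgI.
apply/(monomial_ideal_msupp Imon) => m mg; apply: contraT => mI.
have [C minC m_out] := minimal_cover_not_dvd Imon FP dP m mI.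
have [i biC] : exists i, b i \notin C.
  apply: (minimal_cover_missed FP b C b_inj _ minC) => M GM.
  rewrite suppE => /(hb M GM) [i i_gt0 biM]; exists i => //.
  by rewrite suppE.
have has_g : has (outside C d) (msupp g) by apply/hasP; exists m.
have /hasP [q q_fg q_out] :=
  msupp_linear_mul_outside C d b i g b_inj biC has_g.
have [covC _] := minsetP minC.
by rewrite (negPf (vertex_cover_in_ideal FP dP C q covC (fgI q q_fg))) in q_out.
Qed.
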